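(* Let $Q$ be a topological groupoid on a topological space $X$ with a path connection $\Gamma$, and let $\mathcal{U}=\{U_i : i\in I\}$ be an open cover of $X$ such that the local subgroupoid $c_{\Gamma}(Q,\mathcal{U})$ of $Q$ is well defined. Then: (i) $glob(c_{\Gamma}(Q,\mathcal{U}))=C_{\Gamma}(Q)$; (ii) $c_{\Gamma}(Q,\mathcal{U})$ is coherent; (iii) if $\mathcal{U}$ is $\Gamma$ path local for $c_{\Gamma}(Q,\mathcal{U})$, then $c_{\Gamma}(Q,\mathcal{U})$ is totally coherent.
   Context: A groupoid $Q$ on $X$ has object set $X$, source $\alpha$ and target $\beta$; $gh$ (also written $g\circ h$) is defined iff $\beta(g)=\alpha(h)$. A topological groupoid on $X$ has topologies on its set of arrows and on its object space $X$ making all structure maps continuous. A subgroupoid is wide if it has all objects. For $U\subseteq X$, $Q|U$ is the full subgroupoid on $U$ (and similarly $H|W$ for a subgroupoid $H$). $\Lambda(Y)$ denotes the space of paths $[0,1]\to Y$ in a topological space $Y$. A path connection in $Q$ is a continuous map $\Gamma:\Lambda(X)\to\Lambda(Q)$ such that (1) $\alpha(\Gamma(\lambda)(t))=\lambda(0)$ and $\beta(\Gamma(\lambda)(t))=\lambda(t)$ for $t\in[0,1]$; (2) (transport condition) if $\psi:[0,1]\to[t_0,t_1]\subseteq[0,1]$ is a homeomorphism then $\Gamma(\lambda)(\psi(t))=\Gamma(\lambda)(\psi(0))\circ\Gamma(\lambda\psi)(t)$ for all $t\in[0,1]$. $C_\Gamma(Q)$ is the set of $g\in Q$ such that there is a path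 $\lambda$ in $X$ with $\Gamma(\lambda)(0)=1_{\alpha(g)}$ and $\Gamma(\lambda)(1)=g$; it is a wide subgroupoid of $Q$. For $U$ open in $X$, $C_\Gamma(Q|U)$ is defined in the same way using paths $\lambda$ in $U$ (for which $\Gamma(\lambda)$ lies in $Q|U$). Local subgroupoids: for $x\in X$, consider pairs $(U,H)$ with $U$ an open neighbourhood of $x$ and $H$ a wide subgroupoid of $Q|U$. Pairs $(U,H)$, $(V,K)$ have the same germ at $x$, $[U,H]_x=[V,K]_x$, iff $H|W=K|W$ for some open $W$ with $x\in W\subseteq U\cap V$. A local subgroupoid $s$ of $Q$ assigns to each $x\in X$ a germ $s(x)$ at $x$ such that each point of $X$ has an open neighbourhood $U$ and a wide subgroupoid $H$ of $Q|U$ with $s(y)=[U,H]_y$ for all $y\in U$ (equivalently, a continuous global section of the sheaf associated to the presheaf $U\mapsto\{\text{wide subgroupoids of } Q|U\}$). For $U$ open in $X$, $s|U$ is the local subgroupoid of $Q|U$ obtained by restricting $s$ to $U$. Order: $[U',H']_x\leq[U,H]_x$ iff there is an open $W$ with $x\in W\subseteq U\cap U'$ and $H'|W$ a subgroupoid of $H|W$; $s\leq t$ iff $s(x)\leq t(x)$ for all $x$. For a wide subgroupoid $H$ of $Q$, $loc(H)(x)=[X,H]_x$. For a local subgroupoid $s$ of $Q$, $glob(s)$ is the intersection of all wide subgroupoids $H$ of $Q$ with $s\leq loc(H)$. For local subgroupoids of $Q|U$, $loc$ and $glob$ are taken relative to $Q|U$. A local subgroupoid $s$ is coherent if $s\leq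 loc(glob(s))$, and totally coherent if $s|U$ is coherent for every open $U\subseteq X$. $c_\Gamma(Q,\mathcal U)$ is given by $c_\Gamma(Q,\mathcal U)(x)=[U_i,C_\Gamma(Q|U_i)]_x$ for $x\in U_i$; it is well defined when for all $i,j\in I$ and $x\in U_i\cap U_j$ there is an open $W$ with $x\in W\subseteq U_i\cap U_j$ and $C_\Gamma(Q|U_i)|W=C_\Gamma(Q|U_j)|W$. The cover $\mathcal U$ is $\Gamma$ path local for $c_\Gamma(Q,\mathcal U)$ if for every open $U\subseteq X$, all $i,j\in I$ and $x\in U_i\cap U_j\cap U$ there is an open $W$ with $x\in W\subseteq U_i\cap U_j\cap U$ and $C_\Gamma(Q|U_i)|W=C_\Gamma(Q|(U_j\cap U))|W$. *)

(* Defs.v *)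
From HB Require Import structures.
From mathcomp Require Import all_boot all_order all_algebra.
From mathcomp Require Import all_classical all_reals all_analysis.
From mathcomp Require Import lra.

Set Implicit Arguments.
Unset Strict Implicit.
Unset Printing Implicit Defensive.

Import Order.TTheory GRing.Theory Num.Theory.
Import numFieldNormedType.Exports.
Local Open Scope classical_set_scope.
Local Open Scope ring_scope.

(* [gcomp g h] (first g, then h) is a total function, but it is only specified,
   and only required to be continuous, on the composable pairs. *)
Record topological_groupoid (X A : topologicalType) := TopologicalGroupoid {
  src : A -> X;
  tgt : A -> X;
  idt : X -> A;
  ginv : A -> A;
  gcomp : A -> A -> A;
  src_idt : forall x, src (idt x) = x;
  tgt_idt : forall x, tgt (idt x) = x;
  src_inv : forall g, src (ginv g) = tgt g;
  tgt_inv : forall g, tgt (ginv g) = src g;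
  src_comp : forall g h, tgt g = src h -> src (gcomp g h) = src g;
  tgt_comp : forall g h, tgt g = src h -> tgt (gcomp g h) = tgt h;
  compA : forall g h k, tgt g = src h -> tgt h = src k ->
    gcomp g (gcomp h k) = gcomp (gcomp g h) k;
  comp1g : forall g, gcomp (idt (src g)) g = g;
  compg1 : forall g, gcomp g (idt (tgt g)) = g;
  compgV : forall g, gcomp g (ginv g) = idt (src g);
  compVg : forall g, gcomp (ginv g) g = idt (tgt g);
  src_continuous : continuous src;
  tgt_continuous : continuous tgt;
  idt_continuous : continuous idt;
  inv_continuous : continuous ginv;
  comp_continuous :
    {within [set gh : A * A | tgt gh.1 = src gh.2],
       continuous (fun gh : A * A => gcomp gh.1 gh.2)}
}.

Section UnitInterval.
Variable R : realType.

Definition unitI := set_type `[0 : R, 1]%classic.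

HB.instance Definition _ := Topological.on unitI.

Lemma unitI0_subproof : (0 : R) \in `[0 : R, 1]%classic.
Proof. by rewrite inE /= in_itv /= lexx ler01. Qed.

Lemma unitI1_subproof : (1 : R) \in `[0 : R, 1]%classic.
Proof. by rewrite inE /= in_itv /= lexx ler01. Qed.

Definition unitI0 : unitI := exist _ 0 unitI0_subproof.
Definition unitI1 : unitI := exist _ 1 unitI1_subproof.

Definition unitI_segment (t0 t1 : unitI) : set unitI :=
  [set t | \val t0 <= \val t <= \val t1].

End UnitInterval.

(* f is a homeomorphism from S onto the subspace B of T. *)
Definition homeomorphism_onto (S T : topologicalType) (f : S -> T)
    (B : set T) :=
  [/\ continuous f, range f = B &
      exists2 g : T -> S, cancel f g & {within B, continuous g}].

Section Paths.
Variables (R : realType) (Y : topologicalType).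

Definition paths := continuousType (unitI R) Y.

HB.instance Definition _ := Choice.on paths.
HB.instance Definition _ := Topological.copy paths
  (initial_topology (fun l : paths => (l : {compact-open, unitI R -> Y}))).

End Paths.

Record path_connection (R : realType) (X A : topologicalType)
    (Q : topological_groupoid X A) := PathConnection {
  plift :> paths R X -> paths R A;
  lift_continuous : continuous plift;
  lift_src : forall l t, src Q (plift l t) = l (unitI0 R);
  lift_tgt : forall l t, tgt Q (plift l t) = l t;
  lift_transport : forall (l : paths R X) (psi : paths R (unitI R))
      (t0 t1 : unitI R),
    homeomorphism_onto psi (unitI_segment t0 t1) ->
    forall t, plift l (psi t)
      = gcomp Q (plift l (psi (unitI0 R))) (plift (l \o psi : paths R X) t)
}.

Section LocalSubgroupoids.
Variables (X A : topologicalType) (Q : topological_groupoid X A).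
Implicit Types (D U V W : set X) (H K : set A).

(* The full subgroupoid Q|D is represented by its set of arrows, and all
   notions for Q|D are obtained by letting D vary; Q itself is the case
   D = setT. For D open, the open sets of the object space of Q|D are the open
   sets of X contained in D. *)
Definition full_on D : set A := [set g | D (src Q g) /\ D (tgt Q g)].

Record wide_subgroupoid D H : Prop := WideSubgroupoid {
  wide_sub : H `<=` full_on D;
  wide_idt : forall x, D x -> H (idt Q x);
  wide_inv : forall g, H g -> H (ginv Q g);
  wide_comp : forall g h, H g -> H h -> tgt Q g = src Q h -> H (gcomp Q g h)
}.

(* H|W *)
Definition restr H W : set A := H `&` full_on W.

Definition germ_rep D (x : X) (p : set X * set A) :=
  [/\ open p.1, p.1 x, p.1 `<=` D & wide_subgroupoid p.1 p.2].

Definition same_germ (x : X) (p q : set X * set A) :=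
  exists W, [/\ open W, W x, W `<=` p.1 `&` q.1 & restr p.2 W = restr q.2 W].

(* [U, H]_x, relative to Q|D, as an equivalence class of representatives. *)
Definition germ D U H (x : X) : set (set X * set A) :=
  [set p | germ_rep D x p /\ same_germ x p (U, H)].

(* For two subgroupoids of the same groupoid, being a subgroupoid amounts to
   inclusion of the sets of arrows. *)
Definition germ_le (x : X) (a b : set (set X * set A)) :=
  exists p q, [/\ a p, b q &
    exists W, [/\ open W, W x, W `<=` p.1 `&` q.1
                & restr p.2 W `<=` restr q.2 W]].

(* Local subgroupoids of Q|D; the values of [section] outside D are
   irrelevant. *)
Record local_subgroupoid D := LocalSubgroupoid {
  section :> X -> set (set X * set A);
  sectionP : forall x, D x -> exists U H, germ_rep D x (U, H) /\
    forall y, U y -> section y = germ D U H y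
}.

Definition section_le D (s t : X -> set (set X * set A)) :=
  forall x, D x -> germ_le x (s x) (t x).

Definition loc D H : X -> set (set X * set A) := germ D D H.

Definition glob D (s : local_subgroupoid D) : set A :=
  \bigcap_(H in [set H | wide_subgroupoid D H /\ section_le D s (loc D H)]) H.

Definition coherent D (s : local_subgroupoid D) :=
  section_le D s (loc D (glob s)).

Lemma restrS H V W : W `<=` V -> restr (restr H V) W = restr H W.
Proof.
move=> WV; apply/seteqP; split=> g; first by case=> -[].
by case=> Hg [Wg1 Wg2]; split=> //; split=> //; split; exact: WV.
Qed.

Lemma same_germ_sym x p q : same_germ x p q -> same_germ x q p.
Proof. by case=> W [oW Wx Ws e]; exists W; split=> //; rewrite setIC. Qed.

Lemma same_germ_trans x p q r :
  same_germ x p q -> same_germ x q r -> same_germ x p r.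
Proof.
move=> [V [oV Vx Vs eV]] [W [oW Wx Ws eW]]; exists (V `&` W); split.
- exact: openI.
- by [].
- by move=> y [/Vs[? _] /Ws[_ ?]].
- rewrite -(@restrS p.2 V) 1?eV ?restrS; try by move=> y [].
  by rewrite -(@restrS q.2 W) 1?eW ?restrS //; move=> y [].
Qed.

Lemma germ_eq D x p q : same_germ x p q ->
  germ D p.1 p.2 x = germ D q.1 q.2 x.
Proof.
case: p q => [U H] [V K] /= e; apply/seteqP; split=> r [rr er]; split=> //.
  exact: same_germ_trans e.
exact/(same_germ_trans er)/same_germ_sym.
Qed.

Lemma wide_restr D U H : U `<=` D -> wide_subgroupoid D H ->
  wide_subgroupoid U (restr H U).
Proof.
move=> UD [s1 s2 s3 s4]; split.
- by move=> g [].
- by move=> x Ux; split; [exact/s2/UD | split; rewrite (src_idt, tgt_idt)].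
- move=> g [Hg [a b]]; split; first exact: s3.
  by split; rewrite (src_inv, tgt_inv).
- move=> g h [Hg [a b]] [Hh [c d]] e; split; first exact: s4.
  by split; rewrite (src_comp e, tgt_comp e).
Qed.

Definition section_restr U (s : X -> set (set X * set A)) (x : X) :=
  s x `&` [set p | p.1 `<=` U].

Lemma section_restrP D (s : local_subgroupoid D) U : open U -> U `<=` D ->
  forall x, U x -> exists V H, germ_rep U x (V, H) /\
    forall y, V y -> section_restr U s y = germ U V H y.
Proof.
move=> oU UD x Ux; have [V [H [[/= oV Vx VD wH] sE]]] := sectionP s (UD _ Ux).
exists (V `&` U), (restr H (V `&` U)); split.
  split; [exact: openI | by [] | exact: subIsetr |].
  exact: wide_restr (@subIsetl _ _ _) wH.
move=> y [Vy Uy]; rewrite /section_restr (sE y Vy); apply/seteqP.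
have e : same_germ y (V, H) (V `&` U, restr H (V `&` U)).
  exists (V `&` U); split=> //=; first exact: openI.
    by move=> z [].
  by rewrite restrS.
split=> p.
  case=> -[[op py pD wp] ep] /= pU; split; first by split.
  exact: same_germ_trans ep e.
case=> -[op py pU wp] ep; split=> //; split.
  by split=> // z /pU/UD.
exact/(same_germ_trans ep)/same_germ_sym.
Qed.

(* s|U, as a local subgroupoid of Q|U. *)
Definition local_restr D (s : local_subgroupoid D) U (oU : open U)
    (UD : U `<=` D) : local_subgroupoid U :=
  LocalSubgroupoid (section_restrP s oU UD).

Definition totally_coherent D (s : local_subgroupoid D) :=
  forall U (oU : open U) (UD : U `<=` D), coherent (local_restr s oU UD).

End LocalSubgroupoids.

Section PathLocal.
Variables (R : realType) (X A : topologicalType).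
Variables (Q : topological_groupoid X A) (Gamma : path_connection R Q).

(* C_Gamma(Q|U); C_Gamma(Q) is the case U = setT. *)
Definition C_Gamma (U : set X) : set A :=
  [set g | exists l : paths R X, [/\ forall t, U (l t),
     Gamma l (unitI0 R) = idt Q (src Q g) & Gamma l (unitI1 R) = g]].

Let I0 := unitI0 R.
Let I1 := unitI1 R.

Lemma clamp_subproof (r : R) :
  Num.max 0 (Num.min 1 r) \in `[0 : R, 1]%classic.
Proof. by rewrite inE /= in_itv /= le_max lexx /= ge_max ler01 ge_min lexx. Qed.

Definition clamp (r : R) : unitI R :=
  exist _ (Num.max 0 (Num.min 1 r)) (clamp_subproof r).

Lemma val_clamp r : 0 <= r <= 1 -> \val (clamp r) = r.
Proof. by move=> /andP[r0 r1] /=; rewrite min_r // max_r. Qed.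

Lemma unitIP (t : unitI R) : 0 <= \val t <= 1.
Proof. by case: t => t /= /[!inE] /=; rewrite in_itv. Qed.

Lemma clampK : cancel (\val : unitI R -> R) clamp.
Proof. by move=> t; apply/val_inj; rewrite val_clamp // unitIP. Qed.

Lemma clamp_continuous : continuous clamp.
Proof.
apply: continuous_comp_initial => r.
apply: (@continuous_max R R); first exact: cvg_cst.
apply: (@continuous_min R R); first exact: cvg_cst.
exact: cvg_id.
Qed.

Lemma val_continuous : continuous (\val : unitI R -> R).
Proof. exact: initial_continuous. Qed.

Definition affine_fun (s e : unitI R) (t : unitI R) : unitI R :=
  clamp (\val s + \val t * (\val e - \val s)).

Lemma affine_continuous s e : continuous (affine_fun s e).
Proof.
move=> t; apply: (@continuous_comp _ _ _
  (fun t : unitI R => \val s + \val t * (\val e - \val s)) clamp); last first.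
  exact: clamp_continuous.
apply: continuousD; first exact: cst_continuous.
apply: continuousM; last exact: cst_continuous.
exact: val_continuous.
Qed.

Definition affine s e : paths R (unitI R) :=
  mkcts (@affine_continuous s e).


Lemma val_affine s e t :
  \val (affine s e t) = \val s + \val t * (\val e - \val s).
Proof.
rewrite [LHS](_ : _ = \val (affine_fun s e t)) // /affine_fun val_clamp //.
have := unitIP s; have := unitIP e; have := unitIP t.
move: (\val s) (\val e) (\val t) => a b c; nra.
Qed.

Lemma affine0 s e : affine s e I0 = s.
Proof. by apply/val_inj; rewrite val_affine /= mul0r addr0. Qed.

Lemma affine1 s e : affine s e I1 = e.
Proof. by apply/val_inj; rewrite val_affine /= mul1r addrC subrK. Qed.

Lemma affine_homeo s e : \val s != \val e ->
  exists t0 t1, homeomorphism_onto (affine s e) (unitI_segment t0 t1).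
Proof.
move=> se; have d0 : \val e - \val s != 0 by rewrite subr_eq0 eq_sym.
pose g (t : unitI R) := clamp ((\val t - \val s) / (\val e - \val s)).
have gK : cancel (affine s e) g.
  move=> t; rewrite /g val_affine addrAC subrr add0r mulfK //.
  by rewrite clampK.
have cg : continuous g.
  move=> t; apply: (@continuous_comp _ _ _
    (fun t : unitI R => (\val t - \val s) / (\val e - \val s)) clamp);
    last first.
    exact: clamp_continuous.
  apply: continuousM; last exact: cst_continuous.
  apply: continuousB; last exact: cst_continuous.
  exact: val_continuous.
have gKr t : 0 <= (\val t - \val s) / (\val e - \val s) <= 1 ->
    affine s e (g t) = t.
  move=> t01; apply/val_inj; rewrite val_affine /g val_clamp // divfK //.
  by rewrite addrC subrK.
have [lt_se|lt_es|/eqP] := ltgtP (\val s) (\val e); last by rewrite (negPf se).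
- exists s, e; split; first exact: affine_continuous.
    apply/seteqP; split=> [_ [t _ <-]|t /= /andP[st te]].
      change (\val s <= \val (affine s e t) <= \val e); rewrite val_affine.
      have := unitIP t; move: lt_se.
      by move: (\val s) (\val e) (\val t) => a b c; nra.
    exists (g t) => //; apply: gKr.
    rewrite divr_ge0 ?subr_ge0 ?(ltW lt_se) //.
    by rewrite ler_pdivrMr ?subr_gt0 // mul1r lerB.
  by exists g => //; exact: continuous_subspaceT.
- exists e, s; split; first exact: affine_continuous.
    apply/seteqP; split=> [_ [t _ <-]|t /= /andP[st te]].
      change (\val e <= \val (affine s e t) <= \val s); rewrite val_affine.
      have := unitIP t; move: lt_es.
      by move: (\val s) (\val e) (\val t) => a b c; nra.
    exists (g t) => //; apply: gKr.
    rewrite -mulrNN -invrN !opprB.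
    rewrite divr_ge0 ?subr_ge0 ?(ltW lt_es) //.
    by rewrite ler_pdivrMr ?subr_gt0 // mul1r lerB.
  by exists g => //; exact: continuous_subspaceT.
Qed.

Lemma paths_eq (Y : topologicalType) (l m : paths R Y) : l =1 m -> l = m.
Proof. by move=> lm; apply/continuousEP. Qed.

Lemma lift_affine (l m : paths R X) s e : \val s != \val e ->
    (forall t, l (affine s e t) = m t) ->
  Gamma l e = gcomp Q (Gamma l s) (Gamma m I1).
Proof.
move=> /affine_homeo[t0 [t1 H]] lm.
have := lift_transport Gamma l H I1; rewrite affine0 affine1 => ->.
by congr (gcomp Q _ (Gamma _ _)); apply: paths_eq.
Qed.

Lemma comp_idem g : tgt Q g = src Q g -> gcomp Q g g = g -> g = idt Q (src Q g).
Proof.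
move=> e gg; rewrite -(compgV Q g) -{2}gg -compA ?src_inv //.
by rewrite compgV -e compg1.
Qed.

Lemma unitI01 : \val I0 != \val I1.
Proof. by rewrite /= eq_sym oner_eq0. Qed.

Lemma lift0 (l : paths R X) : Gamma l I0 = idt Q (l I0).
Proof.
rewrite -(lift_src Gamma l I0); apply: comp_idem.
  by rewrite lift_tgt lift_src.
have [t0 [t1 H]] := affine_homeo unitI01.
have := lift_transport Gamma l H I0; rewrite affine0 => {3}->.
congr (gcomp Q _ (Gamma _ _)); apply/esym/paths_eq => t /=.
congr (l _); apply/val_inj; change (\val (affine I0 I1 t) = \val t).
by rewrite val_affine /= add0r subr0 mulr1.
Qed.

Lemma C_GammaP U g : C_Gamma U g <->
  exists l : paths R X, (forall t, U (l t)) /\ Gamma l I1 = g.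
Proof.
split=> [[l [Ul _ <-]]|[l [Ul <-]]]; first by exists l.
by exists l; split=> //; rewrite -/I0 -/I1 lift0 lift_src.
Qed.

Definition half : unitI R := clamp 2^-1.

Lemma val_half : \val half = 2^-1.
Proof. by rewrite val_clamp //; lra. Qed.

Lemma half0 : \val I0 != \val half.
Proof. by rewrite val_half /=; apply/eqP => ?; lra. Qed.

Lemma half1 : \val half != \val I1.
Proof. by rewrite val_half /=; apply/eqP => ?; lra. Qed.

Definition concat_fun (l m : paths R X) (r : R) : X :=
  if r <= 2^-1 then l (clamp (2 * r)) else m (clamp (2 * r - 1)).

Lemma concat_continuous (l m : paths R X) : l I1 = m I0 ->
  continuous (concat_fun l m).
Proof.
move=> lm; apply/continuous_subspace_setT.
have -> : [set: R] = [set r | r <= 2^-1] `|` [set r | 2^-1 <= r].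
  by apply/seteqP; split=> // r _; exact/orP/le_total.
apply: withinU_continuous.
- exact: closed_le.
- exact: closed_ge.
- pose f1 (r : R) := l (clamp (2 * r)).
  apply: (@subspace_eq_continuous _ _ _ f1 (concat_fun l m)).
    by move=> r /[!inE] /= rh; rewrite /concat_fun /= rh.
  apply: continuous_subspaceT => r.
  apply: (@continuous_comp R (unitI R) X (fun r : R => clamp (2 * r)) l);
    last exact: cts_fun.
  apply: (@continuous_comp R R (unitI R) (fun r : R => 2 * r) clamp).
    by apply: continuousM; [exact: cst_continuous | exact: cvg_id].
  exact: clamp_continuous.
- pose f2 (r : R) := m (clamp (2 * r - 1)).
  apply: (@subspace_eq_continuous _ _ _ f2 (concat_fun l m)).
    move=> r /[!inE] /= rh; rewrite /concat_fun /f2.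
    case: ifPn => // rh'; have -> : r = 2^-1 by apply/le_anti/andP.
    rewrite divff // subrr; have -> : clamp 0 = I0.
      by apply/val_inj; rewrite val_clamp // lexx ler01.
    have -> // : clamp 1 = I1.
    by apply/val_inj; rewrite val_clamp // ler01 lexx.
  apply: continuous_subspaceT => r.
  apply: (@continuous_comp R (unitI R) X (fun r : R => clamp (2 * r - 1)) m);
    last exact: cts_fun.
  apply: (@continuous_comp R R (unitI R) (fun r : R => 2 * r - 1) clamp).
    apply: continuousB; last exact: cst_continuous.
    by apply: continuousM; [exact: cst_continuous | exact: cvg_id].
  exact: clamp_continuous.
Qed.

Lemma concat_path (l m : paths R X) : l I1 = m I0 ->
  exists c : paths R X, [/\ forall t, c (affine I0 half t) = l t,
    forall t, c (affine half I1 t) = m t &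
    forall t, (exists t', c t = l t') \/ (exists t', c t = m t')].
Proof.
move=> lm; have cc : continuous (concat_fun l m \o (\val : unitI R -> R)).
  move=> t; apply: continuous_comp; first exact: val_continuous.
  exact: concat_continuous.
exists (mkcts cc : paths R X); split=> t.
- change (concat_fun l m (\val (affine I0 half t)) = l t).
  rewrite val_affine val_half /concat_fun /= add0r subr0 ifT.
    rewrite mulrCA divff // mulr1; congr (l _); exact: clampK.
  by move: (unitIP t) => /= /andP[_]; lra.
- change (concat_fun l m (\val (affine half I1 t)) = m t).
  rewrite val_affine val_half /concat_fun /=; case: ifPn => th.
    have t0 : \val t = 0 by move: (unitIP t) th => /= /andP[+ _]; lra.
    have -> : t = I0 by exact/val_inj.
    rewrite /= mul0r addr0 divff // -lm; congr (l _); apply/val_inj.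
    by rewrite val_clamp // ler01 lexx.
  rewrite -[in RHS](clampK t); congr (m (clamp _)); rewrite /=; lra.
- have [th|th] := boolP (\val t <= 2^-1).
    left; exists (clamp (2 * \val t)).
    by change (concat_fun l m (\val t) = l (clamp (2 * \val t)));
      rewrite /concat_fun th.
  right; exists (clamp (2 * \val t - 1)).
  by change (concat_fun l m (\val t) = m (clamp (2 * \val t - 1)));
    rewrite /concat_fun (negPf th).
Qed.

Lemma C_Gamma_wide U : wide_subgroupoid Q U (C_Gamma U).
Proof.
split.
- move=> g /C_GammaP[l [Ul <-]].
  by split; rewrite (lift_src, lift_tgt).
- move=> x Ux; apply/C_GammaP.
  have cx : continuous (cst x : unitI R -> X).
    by move=> ?; exact: cst_continuous.
  exists (mkcts cx : paths R X); split=> //; set c := (mkcts cx : paths R X).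
  have h1 : Gamma c half = gcomp Q (Gamma c I0) (Gamma c I1).
    exact: lift_affine half0 _.
  have h2 : Gamma c I1 = gcomp Q (Gamma c half) (Gamma c I1).
    exact: lift_affine half1 _.
  have h3 : Gamma c I0 = gcomp Q (Gamma c I1) (Gamma c I1).
    by apply: lift_affine => //; rewrite eq_sym unitI01.
  have e : gcomp Q (Gamma c I0) (Gamma c I1) = Gamma c I1.
    by rewrite lift0 -(lift_src Gamma c I1) comp1g.
  by rewrite h2 h1 e -h3 lift0.
- move=> g /C_GammaP[l [Ul <-]]; apply/C_GammaP.
  exists (l \o affine I1 I0 : paths R X); split; first by move=> t; exact: Ul.
  set m := (l \o _ : paths R X).
  have h : Gamma l I0 = gcomp Q (Gamma l I1) (Gamma m I1).
    by apply: lift_affine => //; rewrite eq_sym unitI01.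
  have sm : tgt Q (Gamma l I1) = src Q (Gamma m I1).
    rewrite lift_tgt lift_src; congr (l _); apply/esym; exact: affine0.
  have := congr1 (gcomp Q (ginv Q (Gamma l I1))) h.
  rewrite compA ?tgt_inv // compVg sm comp1g => <-.
  by rewrite lift0 -(lift_src Gamma l I1) -tgt_inv compg1.
- move=> _ _ /C_GammaP[l [Ul <-]] /C_GammaP[m [Um <-]].
  rewrite lift_tgt lift_src => lm; apply/C_GammaP.
  have [c [cl cm clm]] := concat_path lm.
  exists c; split.
    by move=> t; case: (clm t) => -[t' ->].
  rewrite (lift_affine half1 cm); congr (gcomp Q _ _).
  rewrite (lift_affine half0 cl).
  have c0 : c I0 = l I0 by rewrite -(cl I0) affine0.
  by rewrite lift0 c0 -(lift_src Gamma l I1) comp1g.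
Qed.

Section Cover.
Variables (I : Type) (U : I -> set X).

Definition c_Gamma_well_defined := forall i j x, (U i `&` U j) x ->
  exists W, [/\ open W, W x, W `<=` U i `&` U j &
    restr Q (C_Gamma (U i)) W = restr Q (C_Gamma (U j)) W].

(* The germ [U_i, C_Gamma(Q|U_i)]_x for any i with x in U_i, obtained as the
   union of these (equal) classes; see c_GammaE. *)
Definition c_Gamma_section (x : X) : set (set X * set A) :=
  \bigcup_(i in [set i | U i x]) germ Q setT (U i) (C_Gamma (U i)) x.

Hypothesis wd : c_Gamma_well_defined.

Lemma c_Gamma_sectionE i x : U i x ->
  c_Gamma_section x = germ Q setT (U i) (C_Gamma (U i)) x.
Proof.
move=> Uix; apply/seteqP; split=> [p [j /= Ujx]|p pi]; last by exists i.
have e : same_germ Q x (U j, C_Gamma (U j)) (U i, C_Gamma (U i)).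
  exact: wd.
by rewrite (germ_eq setT e).
Qed.

Hypothesis oU : forall i, open (U i).
Hypothesis covU : \bigcup_i U i = setT.

Lemma c_Gamma_sectionP x : [set: X] x ->
  exists V H, germ_rep Q setT x (V, H) /\
    forall y, V y -> c_Gamma_section y = germ Q setT V H y.
Proof.
move=> _; have [i _ Uix] : (\bigcup_i U i) x by rewrite covU.
exists (U i), (C_Gamma (U i)); split.
  split; [exact: oU | exact: Uix | exact: subsetT | exact: C_Gamma_wide].
by move=> y; exact: c_Gamma_sectionE.
Qed.

Definition c_Gamma : local_subgroupoid Q setT :=
  LocalSubgroupoid c_Gamma_sectionP.

Definition Gamma_path_local := forall V, open V -> forall i j x,
  (U i `&` U j `&` V) x ->
  exists W, [/\ open W, W x, W `<=` U i `&` U j `&` V &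
    restr Q (C_Gamma (U i)) W = restr Q (C_Gamma (U j `&` V)) W].

End Cover.

End PathLocal.

(* Main.v *)
Require Import Defs.
From mathcomp Require Import all_boot all_order all_algebra.
From mathcomp Require Import all_classical all_reals all_analysis.
From mathcomp Require Import lra.

Set Implicit Arguments.
Unset Strict Implicit.
Unset Printing Implicit Defensive.

Import Order.TTheory GRing.Theory Num.Theory.
Import numFieldNormedType.Exports.

Local Open Scope classical_set_scope.
Local Open Scope ring_scope.

(** The heart of the matter is that C_Gamma(Q|D) is generated by its elements
    coming from short paths.  By the transport condition, moving along a path
    l from time s to time e multiplies [Gamma l s] on the right by the lift of
    the piece of l between s and e.  So if a wide subgroupoid K of Q|D
    contains C_Gamma(Q|W) for small W around each point of D, membership of
    [Gamma l t] in K is a locally constant condition on t; it holds at t = 0,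
    where the lift is an identity, hence at t = 1, because an interval is
    connected.  This is [C_Gamma_sub]; connectedness does the work of a
    Lebesgue subdivision of the path.

    If a local subgroupoid s of Q|D is given near each point by some [V, H]
    with C_Gamma(Q|V) contained in H, every K competing in the definition of
    glob s satisfies this hypothesis, so C_Gamma(Q|D) is contained in glob s
    ([C_Gamma_sub_glob]).  For s = c_Gamma(Q, U) and D = X the converse
    inclusion holds because C_Gamma(Q) itself competes: it contains every
    C_Gamma(Q|U_i).  This gives the value of glob, and coherence follows since
    C_Gamma(Q|U_i) lies in C_Gamma(Q).

    For the restriction to an open V, the representing subgroupoid
    C_Gamma(Q|U_i) restricted to U_i n V may contain lifts of paths that leave
    V, so it need not lie in C_Gamma(Q|V).  Path locality, applied with
    j = i, says exactly that it does after shrinking the neighbourhood: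
    there it coincides with C_Gamma(Q|(U_i n V)), which is contained in
    C_Gamma(Q|V) and therefore in glob(s|V). *)

Section Germs.
Variables (X A : topologicalType) (Q : topological_groupoid X A).
Implicit Types (D U V W : set X) (H K : set A).

Lemma full_on_wide D : wide_subgroupoid Q D (full_on Q D).
Proof.
split=> //.
- by move=> x Dx; split; rewrite (src_idt, tgt_idt).
- by move=> g [a b]; split; rewrite (src_inv, tgt_inv).
- by move=> g h [a b] [c d] e; split; rewrite (src_comp e, tgt_comp e).
Qed.

(** The order of germs is defined through arbitrary representatives; shrinking
    W to where they agree with the given ones removes this choice. *)
Lemma germ_le_locP D U H K x : open D -> D x ->
    germ_rep Q D x (U, H) -> wide_subgroupoid Q D K ->
  germ_le Q x (germ Q D U H x) (loc Q D K x) <->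
  exists W, [/\ open W, W x, W `<=` U & restr Q H W `<=` K].
Proof.
move=> oD Dx rU wK; split; last first.
  case=> W [oW Wx WU HK]; have [_ _ UD _] := rU.
  exists (U, H), (D, K); split.
  - by split=> //; exists U; case: (rU).
  - by split; [split | exists D].
  exists W; split=> //= [y Wy|g Hg].
    by split; [exact: WU | exact/UD/WU].
  by split; [exact: HK | case: Hg].
case=> -[U1 H1] [[D2 K2] [[_ [V [oV Vx VU eV]]] [_ [V' [oV' Vx' VU' eV']]]]].
case=> W [oW Wx _ le]; exists (W `&` (V `&` V')); split=> //.
- by apply: openI => //; exact: openI.
- by move=> y [_ [/VU[]]].
move=> g [Hg [[Wg [Vg Vg']] [Wg1 [Vg1 Vg1']]]].
have : restr Q H V g by split.
rewrite -[H]/(U, H).2 -eV => -[Hg1 _].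
have : restr Q K2 W g by apply: le; split.
case=> Kg _; have : restr Q K2 V' g by split.
by rewrite -[K2]/(D2, K2).2 eV' => -[].
Qed.

(** An empty intersection would be the whole arrow space, which need not lie
    over D; but Q|D itself belongs to the family defining [glob s]. *)
Lemma glob_wide D (s : local_subgroupoid Q D) : open D ->
  wide_subgroupoid Q D (glob s).
Proof.
move=> oD.
have full_ge : section_le Q D s (loc Q D (full_on Q D)).
  move=> x Dx; have [V [H [rV ->]]] := sectionP s Dx; last by case: rV.
  apply/germ_le_locP => //; first exact: full_on_wide.
  have [oV Vx VD wH] := rV.
  exists V; split=> // g [Hg _].
  by have [a b] := wide_sub wH Hg; split; exact: VD.
split.
- by move=> g; apply; split; [exact: full_on_wide | exact: full_ge].
- by move=> x Dx H [wH _]; exact: (wide_idt wH).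
- by move=> g Gg H wH; apply: (wide_inv wH.1); exact: Gg.
- move=> g h Gg Gh e H wH.
  by apply: (wide_comp wH.1) => //; [exact: Gg | exact: Gh].
Qed.

Lemma coherentI D (s : local_subgroupoid Q D) : open D ->
    (forall x, D x -> exists V H, [/\ germ_rep Q D x (V, H),
      s x = germ Q D V H x &
      exists W, [/\ open W, W x, W `<=` V & restr Q H W `<=` glob s]]) ->
  coherent s.
Proof.
move=> oD locs x Dx; have [V [H [rV -> gW]]] := locs x Dx.
by apply/germ_le_locP => //; exact: glob_wide.
Qed.

Lemma section_restr_germ D U V H (s : X -> set (set X * set A)) x :
    open V -> V `<=` D -> V x -> germ_rep Q D x (U, H) ->
    s x = germ Q D U H x ->
  section_restr V s x = germ Q V (U `&` V) (restr Q H (U `&` V)) x.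
Proof.
move=> oV VD Vx [/= oU Ux UD wH] sx; rewrite /section_restr sx.
have e : same_germ Q x (U, H) (U `&` V, restr Q H (U `&` V)).
  exists (U `&` V); split=> //=; first exact: openI.
    by move=> z [].
  by rewrite restrS.
apply/seteqP; split=> p.
  case=> -[[op px pD wp] ep] /= pV; split; first by split.
  exact: same_germ_trans ep e.
case=> -[op px pV wp] ep; split=> //; split.
  by split=> // z /pV/VD.
exact/(same_germ_trans ep)/same_germ_sym.
Qed.

End Germs.

Section Subdivision.
Variables (R : realType) (X A : topologicalType).
Variables (Q : topological_groupoid X A) (Gamma : path_connection R Q).
Implicit Types (D V W : set X) (K : set A).

Lemma C_Gamma_mono V W : V `<=` W -> C_Gamma Gamma V `<=` C_Gamma Gamma W.
Proof.
by move=> VW g [l [Vl l0 l1]]; exists l; split=> // t; exact: VW.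
Qed.

(** The connectedness of the line, in the form of an induction principle: a
    locally constant condition that holds somewhere holds everywhere. *)
Lemma locally_constant_setT (B : set R) : B !=set0 ->
  (forall r, \forall r' \near r, B r' <-> B r) -> B = setT.
Proof.
move=> B0 locB.
have oB : open B.
  by move=> r Br; apply: filterS (locB r) => r' [_]; exact.
have oBC : open (~` B).
  by move=> r Br; apply: filterS (locB r) => r' [b _] /b.
have : connected [set: R] by apply/connected_intervalP.
apply => //; first by exists B => //; rewrite setTI.
by exists B; rewrite ?setTI // -[B]setCK; exact: open_closedC.
Qed.

Lemma ball_affine (c e x y z : R) : 0 <= z <= 1 -> ball c e x -> ball c e y ->
  ball c e (x + z * (y - x)).
Proof.
rewrite /ball /= !ltr_distlC => /andP[? ?] /andP[? ?] /andP[? ?].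
have [xy|yx] := leP x y.
  have [? ?] : x <= x + z * (y - x) /\ x + z * (y - x) <= y by split; nra.
  by apply/andP; split; lra.
have [? ?] : y <= x + z * (y - x) /\ x + z * (y - x) <= x by split; nra.
by apply/andP; split; lra.
Qed.

(** No order between s and e is assumed, since a piece of path may be
    traversed in either direction.  The case s = e is separate because the
    transport condition only speaks of nondegenerate reparametrizations. *)
Lemma C_Gamma_step W K D (l : paths R X) (s e : unitI R) :
    wide_subgroupoid Q D K -> C_Gamma Gamma W `<=` K ->
    (forall t, W (l (affine s e t))) ->
  K (Gamma l s) -> K (Gamma l e).
Proof.
move=> wK WK Wl Ks.
have [->//|se] := eqVneq e s.
have vse : \val s != \val e by rewrite eq_sym (inj_eq val_inj).
pose m : paths R X := l \o affine s e.
rewrite (@lift_affine _ _ _ _ Gamma l m s e vse) //.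
apply: (wide_comp wK) => //.
  by apply: WK; apply/C_GammaP; exists m; split.
rewrite lift_tgt lift_src; congr (l _).
exact/esym/affine0.
Qed.

(** A wide subgroupoid that contains the lifts of all short paths contains the
    lifts of all paths. *)
Lemma C_Gamma_sub D K : wide_subgroupoid Q D K ->
    (forall x, D x -> exists W, [/\ open W, W x & C_Gamma Gamma W `<=` K]) ->
  C_Gamma Gamma D `<=` K.
Proof.
move=> wK locK g /C_GammaP[l [Dl <-]].
pose B : set R := [set r | K (Gamma l (clamp r))].
suff BT : B = setT.
  have : B 1 by rewrite BT.
  rewrite /B /=; congr (K (Gamma l _)); apply/val_inj.
  by rewrite val_clamp // ler01 lexx.
(* Extending the condition to the whole line by clamping the parameter lets
   the connectedness of R replace that of [0, 1]. *)
apply: locally_constant_setT.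
  exists 0; rewrite /B /= (_ : clamp 0 = unitI0 R); last first.
    by apply/val_inj; rewrite val_clamp // ler01 lexx.
  by rewrite Defs.lift0; exact: (wide_idt wK).
move=> r; set s := clamp r.
have [W [oW Ws WK]] := locK _ (Dl s).
have cl : continuous (fun v : R => l (clamp v)).
  move=> v; apply: (@continuous_comp R (unitI R) X (@clamp R) l).
    exact: clamp_continuous.
  exact: cts_fun.
have /nbhs_ballP[e /= e0 be] : nbhs (\val s) (fun v : R => W (l (clamp v))).
  by apply: cl; apply: open_nbhs_nbhs; rewrite clampK.
have cv : continuous (fun v : R => \val (clamp v)).
  move=> v; apply: (@continuous_comp R (unitI R) R (@clamp R) \val).
    exact: clamp_continuous.
  exact: val_continuous.
(* The ball is around the clamped parameter s, not around r: both ends of the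
   piece of path are clamped, and the whole piece must stay in the ball. *)
have : \forall r' \near r, ball (\val s) e (\val (clamp r')).
  by apply: cv; exact: nbhsx_ballx.
apply: filterS => r'; set t := clamp r' => st.
have convex_ball a b u : ball (\val s) e (\val a) -> ball (\val s) e (\val b) ->
    W (l (affine a b u)).
  move=> sa sb; rewrite -[affine a b u]clampK; apply: be.
  by rewrite val_affine; apply: ball_affine => //; exact: unitIP.
have ss : ball (\val s) e (\val s) by exact: ballxx.
split; apply: (C_Gamma_step wK WK) => u; exact: convex_ball.
Qed.

(** Every competitor K in the definition of [glob s] contains H, hence the
    lifts of short paths, near each point. *)
Lemma C_Gamma_sub_glob D (s : local_subgroupoid Q D) : open D ->
    (forall x, D x -> exists V H, [/\ germ_rep Q D x (V, H),
      s x = germ Q D V H x & C_Gamma Gamma V `<=` H]) ->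
  C_Gamma Gamma D `<=` glob s.
Proof.
move=> oD locs g Cg K [wK sK]; move: g Cg; apply: C_Gamma_sub => // x Dx.
have [V [H [rV sx CH]]] := locs x Dx.
have := sK x Dx; rewrite sx => /germ_le_locP -/(_ oD Dx rV wK).
case=> W [oW Wx WV HK]; exists W; split=> // g CWg; apply: HK; split.
  exact/CH/(C_Gamma_mono WV).
exact: (wide_sub (C_Gamma_wide Gamma W)).
Qed.

End Subdivision.

Theorem proposition6p14 (R : realType) (X A : topologicalType)
    (Q : topological_groupoid X A) (Gamma : path_connection R Q)
    (I : Type) (U : I -> set X)
    (oU : forall i, open (U i)) (covU : \bigcup_i U i = [set: X])
    (wd : c_Gamma_well_defined Gamma U) :
  [/\ glob (c_Gamma wd oU covU) = C_Gamma Gamma [set: X],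
      coherent (c_Gamma wd oU covU) &
      Gamma_path_local Gamma U -> totally_coherent (c_Gamma wd oU covU)].
Proof.
set s := c_Gamma wd oU covU.
have cov x : exists i, U i x.
  by have [i _ Uix] : (\bigcup_i U i) x; [rewrite covU | exists i].
have rep i x : U i x -> germ_rep Q setT x (U i, C_Gamma Gamma (U i)).
  move=> Uix; split; [exact: oU | exact: Uix | exact: subsetT |].
  exact: C_Gamma_wide.
have sE i x : U i x -> s x = germ Q setT (U i) (C_Gamma Gamma (U i)) x.
  exact: c_Gamma_sectionE.
have CU_glob : C_Gamma Gamma setT `<=` glob s.
  apply: C_Gamma_sub_glob; first exact: openT.
  move=> x _; have [i Uix] := cov x.
  by exists (U i), (C_Gamma Gamma (U i)); split=> //; [exact: rep | exact: sE].
split.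
- apply/seteqP; split=> // g; apply; split; first exact: C_Gamma_wide.
  move=> x _; have [i Uix] := cov x; rewrite (sE i x Uix).
  apply/germ_le_locP => //; [exact: openT | exact: rep | exact: C_Gamma_wide |].
  exists (U i); split=> // h [Ch _]; exact: C_Gamma_mono Ch.
- apply: coherentI; first exact: openT.
  move=> x _; have [i Uix] := cov x.
  exists (U i), (C_Gamma Gamma (U i)); split; [exact: rep | exact: sE |].
  exists (U i); split=> // h [Ch _]; apply: CU_glob; exact: C_Gamma_mono Ch.
- move=> pl V oV VT.
  (* s|V is represented near x by the part of C_Gamma(Q|U_i) over U_i n V. *)
  pose C i := restr Q (C_Gamma Gamma (U i)) (U i `&` V).
  have rsE i x : U i x -> V x ->
      local_restr s oV VT x = germ Q V (U i `&` V) (C i) x.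
    by move=> Uix Vx; exact: section_restr_germ (rep i x Uix) (sE i x Uix).
  have rrep i x : U i x -> V x -> germ_rep Q V x (U i `&` V, C i).
    move=> Uix Vx; split; [exact: openI | by [] | exact: subIsetr |].
    exact: wide_restr (@subIsetl _ _ _) (C_Gamma_wide _ _).
  have CV_glob : C_Gamma Gamma V `<=` glob (local_restr s oV VT).
    apply: C_Gamma_sub_glob => // x Vx; have [i Uix] := cov x.
    exists (U i `&` V), (C i); split; [exact: rrep | exact: rsE |].
    move=> g Cg; split; first exact: C_Gamma_mono Cg.
    exact: (wide_sub (C_Gamma_wide Gamma (U i `&` V))).
  apply: coherentI => // x Vx; have [i Uix] := cov x.
  exists (U i `&` V), (C i); split; [exact: rrep | exact: rsE |].
  have [W [oW Wx WU eW]] := pl V oV i i x (conj (conj Uix Uix) Vx).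
  have WUV : W `<=` U i `&` V by move=> y /WU[[]].
  exists W; split=> //; rewrite /C restrS // eW => g [Cg _].
  by apply: CV_glob; exact: C_Gamma_mono Cg.
Qed.
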